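(* Let $\overline V$ be an $n$-dimensional Minkowski space, and let the coordinates $g_{ij}$ of the metric tensor be defined relative to an orthonormal basis $\overline{\overline e}=(\overline e_1,\dots,\overline e_n)$. Let a motion of $\overline V$, $$v'^i=A^i_jv^j$$ (coordinates relative to $\overline{\overline e}$), map the basis $\overline{\overline e}$ into the orthonormal basis $\overline{\overline e}'=(\overline e'_1,\dots,\overline e'_n)$. Then $$g_{ij}(\overline e'_k)A^i_kA^j_l=g_{kl}(\overline e_k)\qquad\text{for } k\le l$$ (summation over $i,j$, no summation over $k,l$).
   Context: A Minkowski space is a finite-dimensional real vector space $\overline V$ with a Finsler structure $F$ such that: (1) the Finsler metric $F^2$ is real valued and not necessarily positive definite (where $F^2(\overline v)<0$, $F(\overline v)$ is taken to be a positive imaginary number); (2) $F(a\overline x)=aF(\overline x)$ for $a>0$; (3) relative to a basis, the coordinates of the metric tensor $g_{ij}(\overline v)=\frac12\frac{\partial^2F^2(\overline v)}{\partial v^i\partial v^j}$ (the derivatives being assumed to exist at nonzero $\overline v$) form a nonsingular symmetric matrix. One has $g_{ij}(\overline v)v^iv^j=F^2(\overline v)$. A vector $\overline v$ is timelike if $F^2(\overline v)<0$ and spacelike if $F^2(\overline v)>0$; it has unit length if $|F(\overline v)|=1$. Summation over repeated coordinate indices is understood. A basis $\overline{\overline e}=(\overline e_1,\dots,\overline e_n)$, with $e^i_k$ the coordinates of $\overline e_k$, is orthogonal if $g_{ij}(\overline e_k)e_k^ie_k^j\neq 0$ for all $k$ and $g_{ij}(\overline e_k)e_k^ie_l^j=0$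 for $k<l$ (no summation over $k,l$). It is orthonormal if it is orthogonal and its vectors have unit length; thus $g_{ij}(\overline e_k)e_k^ie_k^j$ equals $1$ if $\overline e_k$ is spacelike and $-1$ if $\overline e_k$ is timelike. A motion is a linear transformation of $\overline V$ mapping at least one orthonormal basis into an orthonormal basis. Both $g_{ij}(\overline e_k)$ and $g_{ij}(\overline e'_k)$ are coordinates relative to the same basis $\overline{\overline e}$.
   Formalization: For k = l the equality is stated only when e'_k and e_k are both timelike or both spacelike; without this it fails, e.g. for F² = -x² + y² on R² and the motion that swaps the two standard basis vectors. *)

(* Defs.v *)
(* MathComp / MathComp-Analysis. *)
From mathcomp Require Import all_boot all_order all_algebra.
From mathcomp Require Import complex.
From mathcomp Require Import all_classical all_reals all_analysis.

Set Implicit Arguments.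
Unset Strict Implicit.
Unset Printing Implicit Defensive.

Import Order.TTheory GRing.Theory Num.Theory.
Import numFieldNormedType.Exports.

Local Open Scope ring_scope.
Local Open Scope complex_scope.

Section Minkowski.
Context {R : realType} {V : vectType R}.
Implicit Types (F : V -> R[i]) (v w x : V).

(* [F] is complex valued because it is imaginary on timelike vectors; [F ^ 2]
   is required to be real by [minkowski_real] below, so nothing is lost by [Re]. *)
Definition F2 F v : R := complex.Re (F v ^+ 2).

Definition timelike F v : Prop := F2 F v < 0.
Definition unit_length F v : Prop := `|F v| = 1.

Section Coordinates.
Context {n : nat}.
Implicit Types b e : n.-tuple V.

Definition coords b v : 'rV[R]_n := \row_i coord b i v.

Definition F2_coords F b (y : 'rV[R]_n) : R :=
  F2 F (\sum_(i < n) y 0 i *: b`_i).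

Definition dF2 F b (j : 'I_n) (y : 'rV[R]_n) : R :=
  'D_(delta_mx 0 j) (F2_coords F b) y.

Definition metric F b v : 'M[R]_n :=
  \matrix_(i, j) (2^-1 * 'D_(delta_mx 0 i) (dF2 F b j) (coords b v)).

(* [derive] is a total operator, so existence of the derivatives is a separate
   condition.  Only the partial derivatives are required to exist: neither
   continuity nor Frechet differentiability is assumed. *)
Definition twice_derivable F b : Prop :=
  forall (y : 'rV[R]_n) (i j : 'I_n), y != 0 ->
    derivable (F2_coords F b) y (delta_mx 0 j) /\
    derivable (dF2 F b j) y (delta_mx 0 i).

Definition metric_form F b v w x : R :=
  \sum_(i < n) \sum_(j < n) metric F b v i j * coord b i w * coord b j x.

(* [b] is the basis of reference for the coordinates of the metric tensor and
   of the vectors of [e]. *)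
Definition orthogonal_basis F b e : Prop :=
  [/\ basis_of fullv e,
      forall k : 'I_n, metric_form F b e`_k e`_k e`_k != 0
    & forall k l : 'I_n, (k < l)%N -> metric_form F b e`_k e`_k e`_l = 0].

Definition orthonormal_basis F b e : Prop :=
  orthogonal_basis F b e /\ forall k : 'I_n, unit_length F e`_k.

Definition motion F b (f : {linear V -> V}) : Prop :=
  exists e e', [/\ orthonormal_basis F b e, orthonormal_basis F b e'
    & forall k : 'I_n, f e`_k = e'`_k].

End Coordinates.

Record minkowski_space F : Prop := MinkowskiSpace {
  minkowski_real : forall v, F v ^+ 2 \is Num.real ;
  minkowski_imaginary : forall v, timelike F v ->
    complex.Re (F v) = 0 /\ 0 < complex.Im (F v) ;
  minkowski_homogeneous : forall (a : R) v, 0 < a -> F (a *: v) = a%:C * F v ;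
  minkowski_derivable : forall n (b : n.-tuple V),
    basis_of fullv b -> twice_derivable F b ;
  minkowski_metric : forall n (b : n.-tuple V) v,
    basis_of fullv b -> v != 0 ->
    (metric F b v)^T = metric F b v /\ metric F b v \in unitmx }.

End Minkowski.

(* Main.v *)
(* Off the diagonal the claim is the orthogonality of the two bases.  On the
   diagonal it is Euler's identity g_ij(v) v^i v^j = F^2(v): both sides are then
   +1 or -1 according to the causal type.

   Since only directional derivatives are assumed to exist, Euler's identity
   needs an argument.  The derivative D_u F^2 is itself differentiable along every
   line, so it is separately continuous in every plane, and by Baire's theorem
   separately continuous functions have small oscillation around a dense set of
   points; this makes D_u F^2 linear in u away from the origin.  Hence
   D_w D_u F^2 is linear in u, and by symmetry of the metric tensor (in all bases)
   also in w; homogeneity gives D_v D_v F^2(v) = 2 F^2(v). *)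
Require Import Defs.
From mathcomp Require Import all_boot all_order all_algebra.
From mathcomp Require Import complex.
From mathcomp Require Import all_classical all_reals all_analysis.
From mathcomp Require Import ring lra.

Set Implicit Arguments.
Unset Strict Implicit.
Unset Printing Implicit Defensive.

Import Order.TTheory GRing.Theory Num.Theory.
Import numFieldNormedType.Exports.

Local Open Scope ring_scope.
Local Open Scope complex_scope.

(** * Baire category and separate continuity *)

Section SmallOscillation.
Local Open Scope classical_set_scope.

(** By continuity in [t] at 0 the closed sets [E m] cover an interval around 0, so by Baire's
    theorem one of them contains a nonempty open set. Around a point of it [g s t] is within
    [eps / 2] of [g s 0], and continuity in [s] costs the other half. *)
Lemma separately_continuous_small_oscillation (R : realType) (g : R -> R -> R) :
  (forall t, continuous (g^~ t)) -> (forall s, {for 0, continuous (g s)}) ->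
  forall eps delta : R, 0 < eps -> 0 < delta ->
  exists s0 eta : R, [/\ 0 < eta, `|s0| < delta &
    forall s t, `|s - s0| < eta -> `|t| < eta -> `|g s t - g s0 0| <= eps].
Proof.
move=> g1 g2 eps delta eps0 delta0.
have d20 : 0 < delta / 2 by rewrite divr_gt0.
(* The bound on [s] is built in so that a point of any [E m] is within [delta] of 0. *)
pose E (m : nat) : set R := [set s | `|s| <= delta / 2] `&`
  \bigcap_(t in [set t | `|t| <= m.+1%:R^-1])
    [set s | `|g s t - g s 0| <= eps / 2].
have Ecl m : closed (E m).
  apply: closedI.
    apply: (preimage_closed _ (@closed_le R (delta / 2))) => s _.
    exact: norm_continuous.
  apply: closed_bigI => t _.
  apply: (preimage_closed _ (@closed_le R (eps / 2))) => s _.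
  apply: (@continuous_comp _ _ _ (fun s => g s t - g s 0) Num.norm).
    by apply: continuousB; exact: g1.
  exact: norm_continuous.
have Ecov s : `|s| < delta / 2 -> exists m, E m s.
  move=> sd; have := g2 s; move/cvgrPdist_le => /(_ (eps / 2)).
  rewrite divr_gt0// => /(_ isT) /nbhs_ballP[r /= r0 Hr].
  have [m mr] : exists m, m.+1%:R^-1 < r.
    exists (Num.truncn r^-1).
    by rewrite invf_plt ?posrE// Num.Theory.truncnS_gt.
  exists m; split => [|t /= tm]; first exact: ltW.
  rewrite distrC; apply: Hr.
  by rewrite /ball /= sub0r normrN (le_lt_trans tm).
have [m ndm] : exists m, ~ dense (~` E m).
  (* Were every complement dense, some point of the ball would lie in no [E i], against [Ecov]. *)
  apply/existsNP => dE.
  have /Baire : forall i, open (~` E i) /\ dense (~` E i).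
    by move=> i; split; [exact: closed_openC | exact: dE].
  have b0 : ball (0 : R) (delta / 2) !=set0 by exists 0; exact: ballxx.
  move=> /(_ _ b0 (ball_open _ _))[s [bs Hs]].
  have [|m Ems] := Ecov s; last exact: (Hs m).
  by move: bs; rewrite /ball /= sub0r normrN.
have [U [[s0 [Uo Us0]] UE]] := denseNE ndm.
move: UE => /disjoints_subset; rewrite setCK => UE.
have [s0d Es0] := UE _ Us0.
have /nbhs_ballP[r1 /= r10 Hr1] : nbhs s0 U by exact: open_nbhs_nbhs.
have := g1 0 s0; move/cvgrPdist_le => /(_ (eps / 2)).
rewrite divr_gt0// => /(_ isT) /nbhs_ballP[r2 /= r20 Hr2].
exists s0, (Num.min m.+1%:R^-1 (Num.min r1 r2)); split.
- by rewrite !lt_min r10 r20 invr_gt0 ltr0Sn.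
- by rewrite (le_lt_trans s0d)// ltr_pdivrMr// ltr_pMr// ltr1n.
move=> s t; rewrite !lt_min => /and3P[_ sr1 sr2] /and3P[tm _ _].
have [_ /(_ t (ltW tm)) /= h1] : E m s.
  by apply: UE; apply: Hr1; rewrite /ball /= distrC.
have h2 : `|g s0 0 - g s 0| <= eps / 2 by apply: Hr2; rewrite /ball /= distrC.
rewrite (_ : g s t - g s0 0 = (g s t - g s 0) - (g s0 0 - g s 0)); last by ring.
by rewrite (le_trans (ler_normB _ _))// [leRHS]splitr lerD.
Qed.

End SmallOscillation.

(** * Derivatives along lines *)

Section LineDerivative.
Context {R : realType} {V : vectType R}.
Implicit Types (q : V -> R) (u v w x : V).

(** [V] is only a vector space, without a topology, so [q] is restricted to a line and
    differentiated as a function on [R]. *)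
Definition line_derivable q u x : Prop :=
  derivable (fun t : R => q (x + t *: u)) 0 1.

Definition line_derive q u x : R := 'D_1 (fun t : R => q (x + t *: u)) 0.

Lemma line_is_derive q u x (t : R) : line_derivable q u (x + t *: u) ->
  is_derive t 1 (fun s : R => q (x + s *: u)) (line_derive q u (x + t *: u)).
Proof.
have growthE : (fun h : R => h^-1 *: (((fun s : R => q (x + t *: u + s *: u))
      \o shift 0) (h *: (1 : R)) - q (x + t *: u + (0 : R) *: u))) =
    (fun h : R => h^-1 *: (((fun s : R => q (x + s *: u)) \o shift t)
      (h *: (1 : R)) - q (x + t *: u))).
  by apply/funext => h /=; rewrite addr0 scale0r addr0 -addrA -scalerDl (addrC t).
move=> dq; split; first by move: dq; rewrite /line_derivable /derivable growthE.
by rewrite /line_derive /derive growthE.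
Qed.

Lemma line_continuous q u x (t : R) : line_derivable q u (x + t *: u) ->
  {for t, continuous (fun s : R => q (x + s *: u))}.
Proof.
move=> /line_is_derive[dq _].
exact/differentiable_continuous/derivable1_diffP.
Qed.

Lemma line_deriveZ q u x (c : R) : line_derivable q u x ->
  line_derivable q (c *: u) x /\ line_derive q (c *: u) x = c * line_derive q u x.
Proof.
move=> dq.
have dq0 : is_derive (c *: 0 : R) 1 (fun s : R => q (x + s *: u)) (line_derive q u x).
  by rewrite scaler0; exact: derivableP.
have dc : is_derive (0 : R) 1 (c \*: (@id R)) (c *: 1).
  exact: is_deriveZ.
have := @is_derive1_comp R (fun s : R => q (x + s *: u)) (c \*: (@id R)) 0 _ _ dq0 dc.
rewrite (_ : _ \o _ = fun t : R => q (x + t *: (c *: u))); last first.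
  by apply/funext => t /=; rewrite scalerA mulrC.
rewrite [c *: 1]mulr1 mulrC.
by case=> ? <-; split.
Qed.

(** Some coordinate of [x] is nonzero, and [delta] is so small that the displacement changes it by
    less than its absolute value; the [+ 1] in the denominator makes this strict. *)
Lemma line_avoids0 x u w : x != 0 -> exists2 delta : R, 0 < delta &
  forall s t, `|s| <= delta -> `|t| <= delta -> x + s *: u + t *: w != 0.
Proof.
move=> x0; pose c i := coord (vbasis {:V}) i.
have [i ci] : exists i, c i x != 0.
  apply/existsP; apply: contraNT x0 => /existsPn c0.
  rewrite [x](coord_vbasis (memvf x)) big1// => i _.
  by have := c0 i; rewrite negbK /c => /eqP ->; rewrite scale0r.
have D0 : 0 < `|c i u| + `|c i w| + 1 by rewrite ltr_wpDl ?addr_ge0.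
exists (`|c i x| / (`|c i u| + `|c i w| + 1)).
  by rewrite divr_gt0 ?normr_gt0.
move=> s t hs ht; apply/eqP => /(congr1 (c i)).
rewrite /c !linearD !linearZ linear0 /= -/(c i x) -/(c i u) -/(c i w) => E.
have xE : c i x = - (s * c i u + t * c i w).
  by apply/eqP; rewrite -subr_eq0 opprK addrA; exact/eqP.
have : `|c i x| < `|c i x|; last by rewrite ltxx.
rewrite {1}xE normrN (le_lt_trans (ler_normD _ _))// !normrM.
have := ler_wpM2r (normr_ge0 (c i u)) hs.
have := ler_wpM2r (normr_ge0 (c i w)) ht.
set d := _ / _ => h1 h2.
apply: (le_lt_trans (lerD h2 h1)).
have -> : `|c i x| = d * (`|c i u| + `|c i w| + 1) by rewrite divfK ?gt_eqF.
by rewrite -mulrDr ltr_pM2l ?ltrDl// divr_gt0 ?normr_gt0.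
Qed.

Lemma near0_line_avoids0 x u : x != 0 -> \forall t \near (0 : R), x + t *: u != 0.
Proof.
move=> x0; have [d d0 Hd] := line_avoids0 u 0 x0.
apply/nbhs_ballP; exists d => //= t; rewrite /ball /= sub0r normrN => td.
have := Hd t 0 (ltW td); rewrite normr0 scale0r addr0; apply.
exact: ltW.
Qed.

End LineDerivative.

(** The two-sided limit [d] is already approximated by quotients at small positive [h], and these
    are within [eps] of [G]. *)
Lemma is_derive0_dist_le (R : realType) (phi : R -> R) (d G eps r : R) :
  is_derive (0 : R) (1 : R) phi d -> phi 0 = 0 -> 0 < r ->
  (forall h, 0 < h -> h < r -> `|phi h - G * h| <= eps * h) ->
  `|d - G| <= eps.
Proof.
move=> [dphi <-] phi0 r0 Hr; apply/ler_addgt0Pr => e e0.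
have /cvgrPdist_le/(_ e e0) := dphi.
rewrite near_withinE => /nbhs_ballP[r' /= r'0 Hr'].
pose h := Num.min r r' / 2.
have h0 : 0 < h by rewrite divr_gt0// lt_min r0.
have hlt : h < Num.min r r' by rewrite ltr_pdivrMr// ltr_pMr ?ltr1n// lt_min r0.
move: hlt; rewrite lt_min => /andP[hr hr'].
have := Hr' h; rewrite /ball /= sub0r normrN gtr0_norm// => /(_ hr' (lt0r_neq0 h0)).
rewrite -/(derive phi 0 (1 : R)) addr0 phi0 subr0 [h *: 1]mulr1 => H1.
have H2 : `|h^-1 *: phi h - G| <= eps.
  have -> : h^-1 *: phi h - G = h^-1 * (phi h - G * h).
    by rewrite mulrBr mulrCA mulVf ?mulr1// gt_eqF.
  by rewrite normrM gtr0_norm ?invr_gt0// mulrC ler_pdivrMr// Hr.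
rewrite (_ : _ - G = ('D_1 phi 0 - h^-1 *: phi h) + (h^-1 *: phi h - G)); last by ring.
by rewrite (le_trans (ler_normD _ _))// addrC lerD.
Qed.

(** * Linearity in the direction and Euler's identity *)

Section DirectionalLinearity.
Context {R : realType} {V : vectType R}.
Variable q : V -> R.
Hypothesis dq : forall u x, x != 0 -> line_derivable q u x.
Hypothesis ddq : forall u w x, x != 0 ->
  line_derivable (line_derive q u) w x.

(* A derivative that exists in every direction need not be linear in the
   direction.  Here additivity at [x] follows from additivity, up to an
   arbitrarily small error, at points [x + s0 *: u] where the derivative along
   [w] oscillates little, these points accumulating at [x].  The function [c]
   clamps to a square on which [x + s *: u + t *: w] avoids the origin. *)
Lemma line_deriveD u w x : x != 0 ->
  line_derive q (u + w) x = line_derive q u x + line_derive q w x.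
Proof.
move=> x0; apply/eqP; rewrite -subr_eq0 opprD addrA; apply/negPn/negP => K0.
(* [K] is the defect of additivity. If [K x] is nonzero, continuity along [u] keeps [K] above half
   its size near [x], while a nearby [y] will have a defect of at most a quarter. *)
pose K y := line_derive q (u + w) y - line_derive q u y - line_derive q w y.
rewrite -/(K x) in K0.
have eps0 : 0 < `|K x| / 2 by rewrite divr_gt0 ?normr_gt0.
have [d0 d00 Hd0] := line_avoids0 u w x0.
have Kc : {for 0, continuous (fun s : R => K (x + s *: u))}.
  by apply: continuousB; [apply: continuousB|];
    apply: line_continuous; apply: ddq; rewrite scale0r addr0.
have /nbhs_ballP[d1 /= d10 Hd1] :
    \forall s \near (0 : R), `|K (x + s *: u) - K x| < `|K x| / 2.
  move/cvgrPdist_lt : Kc => /(_ _ eps0); apply: filterS => s.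
  by rewrite scale0r addr0 distrC.
pose c (s : R) := Num.max (- d0) (Num.min d0 s).
have cle s : `|c s| <= d0.
  by rewrite ler_norml /c le_max lexx /= ge_max ge_min lexx /= andbT; lra.
have cid s : `|s| <= d0 -> c s = s.
  by rewrite ler_norml => /andP[h1 h2]; rewrite /c min_r// max_r.
have cc : continuous c.
  move=> s; apply: (@continuous_max _ _ (cst (- d0)) (fun s => Num.min d0 s)).
    exact: cst_continuous.
  by apply: (@continuous_min _ _ (cst d0) id) => //; exact: cst_continuous.
pose g s t := line_derive q w (x + c s *: u + c t *: w).
have g1 t : continuous (g^~ t).
  move=> s; rewrite /g.
  apply: (@continuous_comp _ _ _ c (fun s => line_derive q w (x + s *: u + c t *: w))).
    exact: cc.
  have -> : (fun s => line_derive q w (x + s *: u + c t *: w)) =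
    (fun s => line_derive q w (x + c t *: w + s *: u)).
    by apply/funext => s'; rewrite addrAC.
  by apply: line_continuous; apply: ddq; rewrite addrAC Hd0.
have g2 s : {for 0, continuous (g s)}.
  rewrite /g.
  apply: (@continuous_comp _ _ _ c (fun t => line_derive q w (x + c s *: u + t *: w))).
    exact: cc.
  by apply: line_continuous; apply: ddq; rewrite Hd0.
have e4 : 0 < `|K x| / 4 by rewrite divr_gt0 ?normr_gt0.
have md : 0 < Num.min d0 d1 by rewrite lt_min d00.
have [s0 [eta [eta0 + Hosc]]] :=
  separately_continuous_small_oscillation g1 g2 e4 md.
rewrite lt_min => /andP[s0d0 s0d1].
pose y := x + s0 *: u.
have y0 : y != 0.
  by have := Hd0 s0 0; rewrite normr0 scale0r addr0; apply; exact: ltW.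
have Ky : `|K y| <= `|K x| / 4.
  (* By the mean value theorem [phi h] is [h] times the derivative along [w] at a point
     [y + h *: u + t *: w] with [0 < t < h]. Small oscillation compares it with the derivative at
     [y]. *)
  pose phi h := q (y + h *: (u + w)) - q (y + h *: u).
  have dphi : is_derive (0 : R) (1 : R) phi (line_derive q (u + w) y - line_derive q u y).
    by apply: is_deriveB; apply: derivableP; exact: dq.
  (* The second bound keeps [s0 + h] and [t] where the clamp [c] is the identity. *)
  have r0 : 0 < Num.min eta (d0 - `|s0|) by rewrite lt_min eta0 subr_gt0.
  apply: (is_derive0_dist_le dphi _ r0).
    by rewrite /phi !scale0r subrr.
  move=> h h0; rewrite lt_min => /andP[heta hd0].
  have hd t : t \in `[0, h] -> `|s0 + h| <= d0 /\ `|t| <= d0.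
    rewrite in_itv /= => /andP[t0 th]; split.
      rewrite (le_trans (ler_normD _ _))// (gtr0_norm h0); lra.
    rewrite ger0_norm//; have := normr_ge0 s0; lra.
  have eyt t : y + h *: u + t *: w = x + (s0 + h) *: u + t *: w.
    by rewrite /y scalerDl !addrA.
  have ney t : t \in `[0, h] -> y + h *: u + t *: w != 0.
    by move=> /hd[h1 h2]; rewrite eyt Hd0.
  have dpsi t : t \in `[0, h] -> is_derive t 1 (fun t => q (y + h *: u + t *: w))
      (line_derive q w (y + h *: u + t *: w)).
    by move=> /ney ne; apply: line_is_derive; exact: dq.
  have cpsi : {within `[0, h], continuous (fun t : R => q (y + h *: u + t *: w))}%classic.
    by apply: derivable_within_continuous => t tin; have [] := dpsi _ tin.
  have [t th] := MVT h0 (fun t tin => dpsi t (subset_itv_oo_cc tin)) cpsi.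
  rewrite subr0 scale0r addr0 -addrA -scalerDr -/(phi h) => ->.
  have {}th : t \in `[0, h] by exact: subset_itv_oo_cc.
  have [h1 h2] := hd _ th.
  rewrite -mulrBl normrM (gtr0_norm h0) ler_pM2r//.
  have ct0 : c 0 = 0 by rewrite cid// normr0 ltW.
  have := Hosc (s0 + h) t.
  rewrite /g ct0 (cid _ h1) (cid _ h2) (cid _ (ltW s0d0)) scale0r addr0 -eyt.
  rewrite -/y; apply; first by rewrite addrC addKr gtr0_norm.
  move: th; rewrite in_itv /= => /andP[t0 th].
  by rewrite ger0_norm// (le_lt_trans th).
have := Hd1 s0; rewrite /ball /= sub0r normrN => /(_ s0d1); rewrite -/y.
have := lerB_dist (K x) (K y); rewrite distrC.
move: K0; rewrite -normr_gt0; lra.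
Qed.

Lemma line_derive0 x : line_derive q 0 x = 0.
Proof.
rewrite /line_derive (_ : (fun _ => _) = cst (q x)) ?derive_cst//.
by apply/funext => t; rewrite scaler0 addr0.
Qed.

Hypothesis ddqC : forall u w x, x != 0 ->
  line_derive (line_derive q u) w x = line_derive (line_derive q w) u x.

Lemma line_derive_sum n (c : 'I_n -> R) (e : 'I_n -> V) x : x != 0 ->
  line_derive q (\sum_(i < n) c i *: e i) x = \sum_(i < n) c i * line_derive q (e i) x.
Proof.
move=> x0; rewrite (big_morph (line_derive q ^~ x) (id1 := 0) (op1 := +%R)).
- by apply: eq_bigr => i _; have [_] := line_deriveZ (c i) (@dq (e i) x x0).
- by move=> u w; exact: line_deriveD.
- by rewrite line_derive0.
Qed.

(** First-order linearity holds at [x + t *: w] for all [t] near 0, so it may be differentiated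
    along [w]. *)
Lemma hessian_suml n (c : 'I_n -> R) (e : 'I_n -> V) w x : x != 0 ->
  line_derive (line_derive q (\sum_(i < n) c i *: e i)) w x =
  \sum_(i < n) c i * line_derive (line_derive q (e i)) w x.
Proof.
move=> x0; rewrite [LHS](near_eq_derive (1 : R) (g := \sum_(i < n)
    c i \*: (fun t : R => line_derive q (e i) (x + t *: w)))); last first.
  near=> t; rewrite fct_sumE; apply: line_derive_sum.
  by near: t; exact: near0_line_avoids0.
by apply: derive_val; apply: is_derive_sum => i; apply: is_deriveZ;
  apply: derivableP; exact: ddq.
Unshelve. all: by end_near. Qed.

Hypothesis homogeneous_q : forall (a : R) x, 0 < a -> q (a *: x) = a ^+ 2 * q x.

(** On the ray through [x], [q] is the quadratic [(t + a) ^+ 2 * q x] as long as [t + a] is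
    positive. *)
Lemma line_derive_radial (a : R) x : 0 < a ->
  line_derive q x (a *: x) = 2 * a * q x.
Proof.
move=> a0; rewrite /line_derive.
rewrite (near_eq_derive (1 : R) (g := fun t : R => (t + a) ^+ 2 * q x)).
  have -> : (fun t : R => (t + a) ^+ 2 * q x) =
    (q x \*: ((id + cst a : R -> R) ^+ 2)).
    by apply/funext => t /=; rewrite mulrC.
  rewrite derive_val /=.
  rewrite (_ : (id + cst a) 0 = a); last exact: add0r.
  by rewrite addr0 expr1 /GRing.scale/=; ring.
near=> t; rewrite -scalerDl addrC homogeneous_q//.
near: t; apply/nbhs_ballP; exists a => //= t.
rewrite /ball /= sub0r normrN ltr_norml => /andP[h _]; lra.
Unshelve. all: by end_near. Qed.

Lemma hessian_radial x : line_derive (line_derive q x) x x = 2 * q x.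
Proof.
rewrite [LHS](near_eq_derive (1 : R)
    (g := (2 * q x) \*: (id + cst 1 : R -> R))).
  by rewrite derive_val /= addr0 /GRing.scale/= mulr1.
near=> t; rewrite -[X in X + _]scale1r -scalerDl line_derive_radial.
  by rewrite /= (_ : (id + cst 1) t = t + 1)// /GRing.scale/=; ring.
near: t; apply/nbhs_ballP; exists 1 => //= t.
rewrite /ball /= sub0r normrN ltr_norml => /andP[h _]; lra.
Unshelve. all: by end_near. Qed.

(** Linearity is available in the inner direction only; symmetry exchanges the two directions, so
    that both copies of [x] can be expanded. *)
Lemma hessian_euler n (c : 'I_n -> R) (e : 'I_n -> V) x :
  x = \sum_(i < n) c i *: e i -> x != 0 ->
  \sum_(i < n) \sum_(j < n) line_derive (line_derive q (e j)) (e i) x * c i * c j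
  = 2 * q x.
Proof.
move=> xE x0.
have hessE w : line_derive (line_derive q x) w x =
    \sum_(j < n) c j * line_derive (line_derive q (e j)) w x.
  by have := hessian_suml c e w x0; rewrite -xE.
rewrite -hessian_radial hessE exchange_big; apply: eq_bigr => j _ /=.
rewrite ddqC// hessE mulr_sumr; apply: eq_bigr => i _.
by rewrite ddqC//; ring.
Qed.

End DirectionalLinearity.

(** The assumptions of [minkowski_space] concern basis directions; placing given vectors in a basis
    carries them over to arbitrary directions. *)
Lemma complete_basis (R : realType) (V : vectType R) (X : seq V) : free X ->
  exists n (b : n.-tuple V), basis_of fullv b /\
    {in X, forall v, exists i : 'I_n, b`_i = v}.
Proof.
move=> freeX; set Y := vbasis (<<X>>^C)%VS.
exists (size (X ++ Y)), (in_tuple (X ++ Y)); split=> [|v vX].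
  rewrite -(addv_complf <<X>>) cat_basis ?vbasisP//.
    by apply/directv_addP; exact: capv_compl.
  by rewrite /basis_of eqxx.
have iX : (index v (X ++ Y) < size (X ++ Y))%N by rewrite index_mem mem_cat vX.
by exists (Ordinal iX); exact: (nth_index 0 (etrans (mem_cat _ _ _) (introT orP (or_introl vX)))).
Qed.

(** * From coordinates to directions, and back to the metric tensor *)

Section MinkowskiEuler.
Context {R : realType} {V : vectType R}.
Variable F : V -> R[i].
Hypothesis minkF : minkowski_space F.

Let q := F2 F.

Section InBasis.
Context {n : nat} (b : n.-tuple V).
Hypothesis basis_b : basis_of fullv b.

Let comb (y : 'rV[R]_n) := \sum_(i < n) y 0 i *: b`_i.

Lemma comb_coords v : comb (coords b v) = v.
Proof.
rewrite [RHS](coord_basis basis_b (memvf v)).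
by apply: eq_bigr => i _; rewrite mxE.
Qed.

Lemma coords_neq0 v : v != 0 -> coords b v != 0.
Proof.
apply: contra => /eqP v0; rewrite -(comb_coords v) v0 /comb.
by apply/eqP/big1 => i _; rewrite mxE scale0r.
Qed.

(** Stated for difference quotients as functions, so that both derivability and the value of the
    derivative transfer by rewriting. *)
Lemma coordinate_growth (f : V -> R) (y : 'rV[R]_n) (i : 'I_n) :
  (fun h : R => h^-1 *: (((f \o comb) \o shift y) (h *: delta_mx 0 i)
     - (f \o comb) y)) =
  (fun h : R => h^-1 *: (((fun t : R => f (comb y + t *: b`_i)) \o shift 0)
     (h *: (1 : R)) - f (comb y + (0 : R) *: b`_i))).
Proof.
apply/funext => h /=; rewrite scale0r !addr0 [h *: 1]mulr1; congr (_ *: (f _ - _)).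
rewrite /comb; under eq_bigr do rewrite !mxE eqxx scalerDl.
rewrite big_split /= addrC; congr (_ + _).
rewrite (bigD1 i)//= eqxx mulr1 big1 ?addr0// => j ji.
by rewrite (negbTE ji) mulr0 scale0r.
Qed.

Lemma derive_comb (f : V -> R) (y : 'rV[R]_n) (i : 'I_n) :
  'D_(delta_mx 0 i) (f \o comb) y = line_derive f b`_i (comb y).
Proof. by rewrite /line_derive /derive -coordinate_growth. Qed.

Lemma derivable_comb (f : V -> R) (y : 'rV[R]_n) (i : 'I_n) :
  derivable (f \o comb) y (delta_mx 0 i) -> line_derivable f b`_i (comb y).
Proof. by rewrite /line_derivable /derivable -coordinate_growth. Qed.

Lemma dF2_line_derive (j : 'I_n) : dF2 F b j = line_derive q b`_j \o comb.
Proof. by apply/funext => y; rewrite /dF2 derive_comb. Qed.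

Lemma metric_line_derive v (i j : 'I_n) :
  metric F b v i j = 2^-1 * line_derive (line_derive q b`_j) b`_i v.
Proof. by rewrite mxE dF2_line_derive derive_comb comb_coords. Qed.

Lemma basis_line_derivable v (j : 'I_n) : v != 0 -> line_derivable q b`_j v.
Proof.
move=> v0; rewrite -(comb_coords v); apply: derivable_comb.
by have [] := minkowski_derivable minkF basis_b j j (coords_neq0 v0).
Qed.

Lemma basis_line_derivable2 v (i j : 'I_n) : v != 0 ->
  line_derivable (line_derive q b`_j) b`_i v.
Proof.
move=> v0; rewrite -(comb_coords v); apply: derivable_comb.
rewrite -dF2_line_derive.
by have [] := minkowski_derivable minkF basis_b i j (coords_neq0 v0).
Qed.

Lemma basis_line_deriveC v (i j : 'I_n) : v != 0 ->
  line_derive (line_derive q b`_j) b`_i v = line_derive (line_derive q b`_i) b`_j v.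
Proof.
move=> v0; have [sym _] := minkowski_metric minkF basis_b v0.
have := congr1 (fun M : 'M[R]_n => M j i) sym.
rewrite mxE !metric_line_derive; apply: mulfI.
by rewrite invr_eq0 pnatr_eq0.
Qed.

End InBasis.

Lemma minkowski_line_derivable u x : x != 0 -> line_derivable q u x.
Proof.
move=> x0; have [->|u0] := eqVneq u 0.
  rewrite /line_derivable (_ : (fun _ => _) = cst (q x)); first exact: derivable_cst.
  by apply/funext => t; rewrite scaler0 addr0.
have freeu : free [:: u] by rewrite seq1_free.
have [n [b [bb /(_ u (mem_head _ _))[i <-]]]] := complete_basis freeu.
exact: basis_line_derivable.
Qed.

Lemma direction_cases u w : u != 0 -> (exists c : R, w = c *: u) \/
  exists n (b : n.-tuple V) (i j : 'I_n),
    [/\ basis_of fullv b, b`_i = u & b`_j = w].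
Proof.
move=> u0; have [/vlineP|wu] := boolP (w \in <[u]>%VS); [by left|right].
have freewu : free [:: w; u] by rewrite free_cons span_seq1 wu seq1_free.
have [n [b [bb bX]]] := complete_basis freewu.
have [|i bi] := bX u; first by rewrite !inE eqxx orbT.
have [|j bj] := bX w; first by rewrite !inE eqxx.
by exists n, b, i, j.
Qed.

Lemma line_derivable2_diag u x : u != 0 -> x != 0 ->
  line_derivable (line_derive q u) u x.
Proof.
move=> u0 x0; have freeu : free [:: u] by rewrite seq1_free.
have [n [b [bb /(_ u (mem_head _ _))[i <-]]]] := complete_basis freeu.
exact: basis_line_derivable2.
Qed.

Lemma minkowski_line_derivable2 u w x : x != 0 ->
  line_derivable (line_derive q u) w x.
Proof.
move=> x0; have [->|u0] := eqVneq u 0.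
  rewrite /line_derivable (_ : (fun _ => _) = cst (0 : R)); first exact: derivable_cst.
  by apply/funext => t; rewrite line_derive0.
have [[c ->]|[n [b [i [j [bb <- <-]]]]]] := direction_cases w u0.
  by have [] := line_deriveZ c (line_derivable2_diag u0 x0).
exact: basis_line_derivable2.
Qed.

Lemma line_derive_fun0 w x : line_derive (line_derive q 0) w x = 0.
Proof.
rewrite {1}/line_derive (_ : (fun _ => _) = cst (0 : R)) ?derive_cst//.
by apply/funext => t; rewrite line_derive0.
Qed.

Lemma minkowski_line_deriveC u w x : x != 0 ->
  line_derive (line_derive q u) w x = line_derive (line_derive q w) u x.
Proof.
move=> x0; have [->|u0] := eqVneq u 0.
  by rewrite line_derive_fun0 line_derive0.
have [[c ->]|[n [b [i [j [bb <- <-]]]]]] := direction_cases w u0; last first.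
  exact: basis_line_deriveC.
have [_ ->] := line_deriveZ c (line_derivable2_diag u0 x0).
(* For parallel directions a sum with one term takes the scalar [c] out of the inner direction. *)
have := @hessian_suml _ _ q minkowski_line_derivable minkowski_line_derivable2
  1 (fun=> c) (fun=> u) u x x0.
by rewrite !big_ord1 => ->.
Qed.

Lemma minkowski_F2Z (a : R) x : 0 < a -> q (a *: x) = a ^+ 2 * q x.
Proof.
move=> a0; rewrite /q /F2 (minkowski_homogeneous minkF)// exprMn.
by rewrite -rmorphXn; case: (F x ^+ 2) => r s /=; rewrite mul0r subr0.
Qed.

Lemma metric_form_euler n (b : n.-tuple V) v : basis_of fullv b -> v != 0 ->
  metric_form F b v v v = F2 F v.
Proof.
move=> bb v0; have := hessian_euler minkowski_line_derivable
  minkowski_line_derivable2 minkowski_line_deriveC minkowski_F2Z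
  (coord_basis bb (memvf v)) v0.
move=> /(congr1 ( *%R 2^-1)); rewrite mulKf ?pnatr_eq0// -[F2 F v]/(q v) => <-.
rewrite mulr_sumr; apply: eq_bigr => i _; rewrite mulr_sumr.
by apply: eq_bigr => j _; rewrite metric_line_derive// !mulrA.
Qed.

(** The square of [F v] has modulus 1 and is real, so its modulus is the absolute value of its real
    part. *)
Lemma unit_length_F2 v : unit_length F v -> `|F2 F v| = 1.
Proof.
move=> /(congr1 (fun z => z ^+ 2)); rewrite expr1n -normrX => F1.
have := minkowski_real minkF v; rewrite /F2.
move: (F v ^+ 2) F1 => [r s] rs1.
rewrite complex_real => /eqP s0; move: rs1.
by rewrite s0 normc_def /= expr0n addr0 sqrtr_sqr => /complexI.
Qed.

Lemma eq_F2_unit v w : unit_length F v -> unit_length F w ->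
  (timelike F v <-> timelike F w) -> F2 F v = F2 F w.
Proof.
move=> /unit_length_F2 Fv /unit_length_F2 Fw; rewrite /timelike => vw.
have [v0|v0] := ltrP (F2 F v) 0; have [w0|w0] := ltrP (F2 F w) 0.
- by apply: oppr_inj; rewrite -!ltr0_norm ?Fv.
- by move/vw: v0; rewrite ltNge w0.
- by move/vw: w0; rewrite ltNge v0.
- by rewrite -[LHS]ger0_norm// -[RHS]ger0_norm// Fv.
Qed.

End MinkowskiEuler.

Theorem theorem2p4p4 (R : realType) (n : nat) (V : vectType R)
    (dimV : \dim {:V} = n) (F : V -> R[i]) (minkF : minkowski_space F)
    (e e' : n.-tuple V)
    (one : orthonormal_basis F e e) (one' : orthonormal_basis F e e')
    (f : {linear V -> V}) (motf : motion F e f)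
    (A : 'M[R]_n)
    (fA : forall (v : V) (i : 'I_n),
        coord e i (f v) = \sum_(j < n) A i j * coord e j v)
    (fe : forall k : 'I_n, f e`_k = e'`_k) :
  forall k l : 'I_n, (k <= l)%N ->
    (* On the diagonal the two vectors must have the same causal type. *)
    (k = l -> (timelike F e'`_k <-> timelike F e`_k)) ->
    \sum_(i < n) \sum_(j < n) metric F e e'`_k i j * A i k * A j l =
    metric F e e`_k k l.
Proof.
move=> k l kl causal.
have [[basis_e _ orth_e] unit_e] := one.
have [[basis_e' _ orth_e'] unit_e'] := one'.
have neq0 (b : n.-tuple V) (i : 'I_n) : basis_of fullv b -> b`_i != 0.
  by move=> bb; apply: (basis_not0 bb); rewrite mem_nth ?size_tuple.
have coord_e (i j : 'I_n) : coord e i e`_j = (i == j)%:R.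
  by rewrite coord_free 1?eq_sym// (basis_free basis_e).
(* The columns of [A] are the coordinates of the new basis vectors, which turns the sum into a
   [metric_form]. *)
have coord_e' (i j : 'I_n) : coord e i e'`_j = A i j.
  rewrite -fe fA (bigD1 j)//= coord_e eqxx mulr1 big1 ?addr0// => m mj.
  by rewrite coord_e (negbTE mj) mulr0.
have formE' : \sum_(i < n) \sum_(j < n) metric F e e'`_k i j * A i k * A j l =
    metric_form F e e'`_k e'`_k e'`_l.
  by apply: eq_bigr => i _; apply: eq_bigr => j _; rewrite !coord_e'.
have formE : metric F e e`_k k l = metric_form F e e`_k e`_k e`_l.
  rewrite /metric_form (bigD1 k)//= (bigD1 l)//= !coord_e !eqxx !mulr1.
  rewrite !big1 ?addr0// => [i ik|j jl].
    by rewrite big1// => j _; rewrite coord_e (negbTE ik) mulr0 mul0r.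
  by rewrite coord_e (negbTE jl) mulr0.
rewrite formE' formE; have [kl'|lk|/val_inj kl'] := ltngtP k l.
- by rewrite orth_e ?orth_e'.
- by rewrite leqNgt lk in kl.
- rewrite -kl' !(metric_form_euler minkF basis_e) ?neq0//.
  exact: (eq_F2_unit minkF (unit_e' k) (unit_e k) (causal kl')).
Qed.
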